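(* Let $p$ be a prime and let $n \geq 0$ be an integer with standard base-$p$ representation $n_\ell \cdots n_1 n_0$ (so $n = \sum_{t=0}^{\ell} n_t p^t$ with $n_t \in \{0,1,\dots,p-1\}$). Define \[ T_p(n, x) = \sum_{m = 0}^n x^{\nu_p\left(\binom{n}{m}\right)}, \] and for each $d \in \{0, 1, \dots, p - 1\}$ let \[ M_p(d) = \begin{bmatrix} d + 1 & p - d - 1 \\ d \, x & (p - d) \, x \end{bmatrix}. \] Then \[ T_p(n, x) = \begin{bmatrix} 1 & 0 \end{bmatrix} M_p(n_0) \, M_p(n_1) \, \cdots \, M_p(n_\ell) \begin{bmatrix} 1 \\ 0 \end{bmatrix}. \]
   Context: $\nu_p(N)$ denotes the $p$-adic valuation of a positive integer $N$, i.e. the exponent of the highest power of $p$ dividing $N$. Thus the coefficient of $x^\alpha$ in $T_p(n,x)$ is the number of $m$ with $0 \le m \le n$ and $\nu_p(\binom{n}{m}) = \alpha$. *)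

(* Defs.v *)
From HB Require Import structures.
From mathcomp Require Import all_boot all_order all_algebra.
Set Implicit Arguments.
Unset Strict Implicit.
Unset Printing Implicit Defensive.
Import Order.TTheory GRing.Theory Num.Theory.
Local Open Scope ring_scope.

(* The digits are listed from the least significant one, [ds ord0] = n_0; "standard" excludes
   leading zeros, except that 0 is written with the single digit 0. *)
Definition standard_base_repr (p n l : nat) (ds : 'I_l.+1 -> 'I_p) : Prop :=
  n = (\sum_(t < l.+1) ds t * p ^ t)%N /\ (l = 0%N \/ ds ord_max <> 0%N :> nat).

(* The indeterminate x is ['X]. *)
Definition Tp (p n : nat) : {poly int} :=
  \sum_(m < n.+1) 'X^(logn p 'C(n, m)).

Definition Mp (p : nat) (d : 'I_p) : 'M[{poly int}]_2 :=
  \matrix_(i < 2, j < 2)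
    (nth [::] [:: [:: d%:R + 1 ; p%:R - d%:R - 1];
                  [:: d%:R * 'X; (p%:R - d%:R) * 'X]] i)`_j.

Definition row10 : 'rV[{poly int}]_2 := \row_(j < 2) [:: 1; 0]`_j.
Definition col10 : 'cV[{poly int}]_2 := \col_(i < 2) [:: 1; 0]`_i.

(* Main.v *)
Require Import Defs.
From HB Require Import structures.
From mathcomp Require Import all_boot all_order all_algebra.
From mathcomp Require Import zify.
Import Order.TTheory GRing.Theory Num.Theory.
Local Open Scope ring_scope.

(** Beside T_p(n, x), consider U_p(n, x), the sum over m < n of x to the power
    1 + v_p((n - m) * binomial(n, m)). By Legendre's formula v_p((p n + d)!) = n + v_p(n!)
    for d < p. Hence, writing m = p k + e with e < p, the summand of T_p(p n + d) at m is
    that of T_p(n) at k if e <= d, and that of U_p(n) at k if e > d (a carry occurs); the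
    summand of U_p(p n + d) at m is x times that of T_p(n) at k if e < d, and x times that
    of U_p(n) at k if e >= d. So the column (T_p(p n + d), U_p(p n + d)) is M_p(d) times
    the column (T_p(n), U_p(n)), which for n = 0 is (1, 0). *)

Lemma leq_digit (p n k d e : nat) : (d < p)%N -> (e < p)%N ->
  (p * k + e <= p * n + d)%N = if (e <= d)%N then (k <= n)%N else (k < n)%N.
Proof.
(* Distinct quotients differ by a whole block of length [p], which the digits cannot bridge; digits
   decide only when [k = n]. *)
move=> dp ep; case: (ltngtP k n) => [kn|nk|->]; last by rewrite leq_add2l; case: leqP.
- have : (p * k.+1 <= p * n)%N by rewrite leq_mul2l kn orbT.
  by case: ifP => _; lia.
- have : (p * n.+1 <= p * k)%N by rewrite leq_mul2l nk orbT.
  by case: ifP => _; lia.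
Qed.

Lemma ltn_digit (p n k d e : nat) : (d < p)%N -> (e < p)%N ->
  (p * k + e < p * n + d)%N = if (e < d)%N then (k <= n)%N else (k < n)%N.
Proof. by move=> dp ep; rewrite ltnNge leq_digit //; do 2 case: ifP => ?; lia. Qed.

Lemma logn_addM_eq0 (p n d : nat) : (0 < d < p)%N -> logn p (p * n + d) = 0%N.
Proof.
move=> /andP[d0 dp]; apply/eqP; rewrite eqn0Ngt logn_gt0 mem_primes.
by rewrite dvdn_addr ?dvdn_mulr // gtnNdvd // !andbF.
Qed.

Lemma logn_fact_addM (p n d : nat) : prime p -> (d < p)%N ->
  logn p (p * n + d)`! = (n + logn p n`!)%N.
Proof.
move=> hp; have p_gt0 := prime_gt0 hp.
(* The factors between [p * k] and [p * k + e] are prime to [p]. *)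
have step k e : (e < p)%N -> logn p (p * k + e)`! = logn p (p * k)`!.
  elim: e => [|e IHe] ep; first by rewrite addn0.
  rewrite addnS factS lognM ?fact_gt0 // -addnS logn_addM_eq0 // add0n.
  by rewrite IHe // ltnW.
move=> dp; rewrite step //; elim: n => [|n IHn]; first by rewrite muln0.
(* The only new multiple of [p] is [p * n.+1], which contributes one plus the valuation of
   [n.+1]. *)
have -> : (p * n.+1 = (p * n + p.-1).+1)%N by lia.
rewrite factS lognM ?fact_gt0 // step ?prednK // IHn.
have -> : ((p * n + p.-1).+1 = p * n.+1)%N by lia.
by rewrite lognM // (pfactorK 1 hp) factS lognM ?fact_gt0 //; lia.
Qed.

Lemma logn_bin_fact (p n m : nat) : (m <= n)%N ->
  (logn p 'C(n, m) + (logn p m`! + logn p (n - m)`!) = logn p n`!)%N.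
Proof.
by move=> mn; rewrite -(bin_fact mn) !lognM ?muln_gt0 ?fact_gt0 ?bin_gt0.
Qed.

Lemma logn_bin_no_carry (p n k d e : nat) : prime p -> (k <= n)%N ->
  (e <= d < p)%N -> logn p 'C(p * n + d, p * k + e) = logn p 'C(n, k).
Proof.
move=> hp kn /andP[ed dp].
have le : (p * k + e <= p * n + d)%N by rewrite leq_add // leq_mul2l kn orbT.
have := logn_bin_fact p _ _ le; have := logn_bin_fact p _ _ kn.
have -> : (p * n + d - (p * k + e) = p * (n - k) + (d - e))%N by nia.
by rewrite !logn_fact_addM //; lia.
Qed.

(** Subtracting the digits borrows, so the quotient of the difference is [n - k - 1]. The quotients
    then cancel up to 1, and [(n - k)! = (n - k) * (n - k - 1)!] yields the factor [n - k]. *)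
Lemma logn_bin_carry (p n k d e : nat) : prime p -> (k < n)%N ->
  (d < e < p)%N ->
  logn p 'C(p * n + d, p * k + e) = (logn p ((n - k) * 'C(n, k))).+1.
Proof.
move=> hp kn /andP[de ep].
have le : (p * k + e <= p * n + d)%N by nia.
have := logn_bin_fact p _ _ le; have := logn_bin_fact p _ _ (ltnW kn).
have -> : (p * n + d - (p * k + e) = p * (n - k.+1) + (p + d - e))%N by nia.
rewrite lognM ?bin_gt0 ?subn_gt0 // ?(ltnW kn) //.
rewrite -(subnSK kn) factS lognM ?fact_gt0 // !logn_fact_addM //; lia.
Qed.

(** Extending by 0 lets sums run over complete blocks of length [p]. The guard matters:
    [logn p 0 = 0], so an unguarded summand beyond [n] would be 1. *)
Definition Tterm (p n m : nat) : {poly int} :=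
  if (m <= n)%N then 'X^(logn p 'C(n, m)) else 0.

Definition Uterm (p n m : nat) : {poly int} :=
  if (m < n)%N then 'X^((logn p ((n - m) * 'C(n, m))).+1) else 0.

Definition Up (p n : nat) : {poly int} := \sum_(0 <= m < n) Uterm p n m.

Lemma TtermE (p n k d e : nat) : prime p -> (d < p)%N -> (e < p)%N ->
  Tterm p (p * n + d) (p * k + e) =
    if (e < d.+1)%N then Tterm p n k else Uterm p n k.
Proof.
move=> hp dp ep; rewrite /Tterm /Uterm ltnS; case: (leqP e d) => [ed|de].
  rewrite leq_digit // ed.
  by case: ifP => // kn; rewrite logn_bin_no_carry // ed.
rewrite leq_digit // leqNgt de /=.
by case: ifP => // kn; rewrite logn_bin_carry // de.
Qed.

Lemma UtermE (p n k d e : nat) : prime p -> (d < p)%N -> (e < p)%N ->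
  Uterm p (p * n + d) (p * k + e) =
    if (e < d)%N then 'X * Tterm p n k else 'X * Uterm p n k.
Proof.
move=> hp dp ep; rewrite /Tterm /Uterm.
(* For [e <> d] the difference of the arguments is prime to [p], so only the binomial counts. For
   [e = d] the difference is [p * (n - k)]: its factor [p] gives the extra ['X], and [n - k] turns
   the term into one of [Uterm]. *)
case: (ltngtP e d) => [ed|de|->].
- rewrite ltn_digit // ed.
  case: ifP => [kn|_]; last by rewrite mulr0.
  have -> : (p * n + d - (p * k + e) = p * (n - k) + (d - e))%N by nia.
  rewrite lognM ?bin_gt0; try nia.
  by rewrite logn_addM_eq0 ?logn_bin_no_carry ?exprS //; lia.
- rewrite ltn_digit // ltnNge (ltnW de) /=.
  case: ifP => [kn|_]; last by rewrite mulr0.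
  have -> : (p * n + d - (p * k + e) = p * (n - k.+1) + (p + d - e))%N by nia.
  rewrite lognM ?bin_gt0; try nia.
  by rewrite logn_addM_eq0 ?logn_bin_carry ?de // -?exprS //; lia.
- rewrite ltn_digit // ltnn.
  case: ifP => [kn|_]; last by rewrite mulr0.
  have -> : (p * n + d - (p * k + d) = p * (n - k))%N by nia.
  rewrite -exprS !lognM ?bin_gt0 ?muln_gt0 ?subn_gt0 ?prime_gt0 ?(ltnW kn) //; last by nia.
  by rewrite logn_bin_no_carry ?leqnn ?(ltnW kn) // (pfactorK 1 hp).
Qed.

Lemma Tp_nat (p n N : nat) : (n < N)%N -> Tp p n = \sum_(0 <= m < N) Tterm p n m.
Proof.
move=> nN; rewrite (big_cat_nat (n := n.+1)) //= [X in _ + X]big_nat [X in _ + X]big1 => [|m].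
  rewrite addr0 big_mkord; apply: eq_bigr => m _.
  by rewrite /Tterm -ltnS ltn_ord.
by move=> /andP[nm _]; rewrite /Tterm leqNgt nm.
Qed.

Lemma Up_nat (p n N : nat) : (n <= N)%N -> Up p n = \sum_(0 <= m < N) Uterm p n m.
Proof.
move=> nN; rewrite [RHS](big_cat_nat (n := n)) //= [X in _ + X]big_nat [X in _ + X]big1 ?addr0 // => m.
by move=> /andP[nm _]; rewrite /Uterm ltnNge nm.
Qed.

Lemma big_nat_blocks (V : nmodType) (p N : nat) (f : nat -> V) :
  \sum_(0 <= m < p * N) f m = \sum_(0 <= k < N) \sum_(0 <= e < p) f (p * k + e)%N.
Proof.
elim: N => [|N IHN]; first by rewrite muln0 !big_geq.
rewrite big_nat_recr //= -IHN mulnSr (big_cat_nat (n := (p * N)%N)) ?leq_addr //=.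
congr (_ + _); rewrite -{1}[(p * N)%N]add0n big_addn addKn.
by apply: eq_bigr => e _; rewrite addnC.
Qed.

Lemma sum_if_ltn (V : nmodType) (p c : nat) (a b : V) : (c <= p)%N ->
  \sum_(0 <= e < p) (if (e < c)%N then a else b) = a *+ c + b *+ (p - c).
Proof.
move=> cp; rewrite (big_cat_nat (n := c)) //=; congr (_ + _).
  under eq_big_nat => e /andP[_ ec] do rewrite ec.
  by rewrite sumr_const_nat subn0.
under eq_big_nat => e /andP[ce _] do rewrite ltnNge ce /=.
by rewrite sumr_const_nat.
Qed.

(** In each block of [p] consecutive indices, the last digit selects [a k] for [c] values and [b k]
    for the other [p - c]. *)
Lemma sum_digit_blocks (p n c : nat) (f a b : nat -> {poly int}) : (c <= p)%N ->
  (forall k e, (e < p)%N -> f (p * k + e)%N = if (e < c)%N then a k else b k) ->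
  \sum_(0 <= m < p * n) f m =
    c%:R * \sum_(0 <= k < n) a k + (p%:R - c%:R) * \sum_(0 <= k < n) b k.
Proof.
move=> cp fE; rewrite big_nat_blocks !mulr_sumr -big_split /=.
apply: eq_bigr => k _; under eq_big_nat => e /andP[_ ep] do rewrite fE //.
by rewrite sum_if_ltn // -natrB // !mulr_natl.
Qed.

Lemma Tp_rec (p n d : nat) : prime p -> (d < p)%N ->
  Tp p (p * n + d) = (d%:R + 1) * Tp p n + (p%:R - d%:R - 1) * Up p n.
Proof.
(* The bound [p * n.+1] completes the last block, that of [k = n]. *)
move=> hp dp; rewrite (@Tp_nat _ _ (p * n.+1)) ?(@Tp_nat _ n n.+1) ?(@Up_nat _ n n.+1) //.
  rewrite (@sum_digit_blocks _ _ d.+1 _ (Tterm p n) (Uterm p n)) // => [|k e ep].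
    by rewrite -natr1 opprD addrA.
  exact: TtermE.
by rewrite mulnS addnC ltn_add2r.
Qed.

Lemma Up_rec (p n d : nat) : prime p -> (d < p)%N ->
  Up p (p * n + d) = d%:R * 'X * Tp p n + (p%:R - d%:R) * 'X * Up p n.
Proof.
move=> hp dp; rewrite (@Up_nat _ (p * n + d) (p * n.+1)).
  rewrite (@Tp_nat _ n n.+1) // (@Up_nat _ n n.+1) //.
  rewrite (@sum_digit_blocks _ _ d _ (fun k => 'X * Tterm p n k)
    (fun k => 'X * Uterm p n k)) 1?ltnW // => [|k e ep].
    by rewrite -!mulr_sumr !mulrA.
  exact: UtermE.
by rewrite mulnS addnC leq_add2r ltnW.
Qed.

(** Both entries are tracked because each recurrence involves both. *)
Lemma prod_Mp_col10 (p l : nat) (ds : 'I_l -> 'I_p) : prime p ->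
  let n := (\sum_(t < l) ds t * p ^ t)%N in
  (\prod_(t < l) Mp (ds t)) *m col10 = \col_(i < 2) [:: Tp p n; Up p n]`_i.
Proof.
move=> hp; elim: l ds => [|l IHl] ds /=.
  by rewrite !big_ord0 mul1mx /Tp /Up big_ord1 bin0 logn1 expr0 big_geq //.
(* A Horner step: the least significant digit, whose matrix is leftmost, is split off. *)
have -> : (\sum_(t < l.+1) ds t * p ^ t =
    p * (\sum_(t < l) ds (lift ord0 t) * p ^ t) + ds ord0)%N.
  rewrite big_ord_recl expn0 muln1 addnC big_distrr /=; congr (_ + _)%N.
  by apply: eq_bigr => t _; rewrite expnS mulnCA.
rewrite big_ord_recl -mulmxE -mulmxA IHl.
apply/colP => i; rewrite !mxE big_ord_recl big_ord1 !mxE /=.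
by case: i => [[|[|//]] ?] /=; rewrite ?Tp_rec ?Up_rec.
Qed.

Theorem theorem1 (p : nat) (hp : prime p) (n l : nat) (ds : 'I_l.+1 -> 'I_p)
    (hds : standard_base_repr n ds) :
  Tp p n = (row10 *m (\prod_(t < l.+1) Mp (ds t)) *m col10) ord0 ord0.
Proof.
case: hds => nE _; rewrite -mulmxA prod_Mp_col10 // -nE.
by rewrite !mxE big_ord_recl big_ord1 !mxE /= mul1r mul0r addr0.
Qed.
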